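(* Let $\mathcal A$ be an ultracategory (in Lurie's sense) which is a pseudo-algebra for the pseudomonad $T$, i.e. whose colax associators $a$ are all invertible, and let $\mathcal B$ be any full subcategory of $\mathcal A$. Then there is a canonical generalised ultrastructure on $\mathcal B$, given as follows: for objects $A$, $(M_i)_{i\in I}$ of $\mathcal B$ and an ultrafilter $\mu$ on $I$, $$\mathrm{Hom}\Big(A,\int_I M_i\,d\mu\Big):=\mathrm{Hom}_{\mathcal A}\Big(A,\int_I M_i\,d\mu\Big),$$ where on the right the ultraproduct is taken in $\mathcal A$; $\beta(f,[g_i]):=a^{-1}\circ\big(\int_I g_i\,d\mu\big)\circ f$; $\Xi_{f,\mu}$ is postcomposition with the ultraproduct diagonal map $\Delta_{\mu,f}$; and $\kappa_A:=\epsilon_{*,*}^{-1}:A\to\int_*A\,d*$. That is, these data satisfy the axioms of a generalised ultracategory.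
   Context: **Ultrafilters.** $f\mu$ is the pushforward of an ultrafilter $\mu$ along a map $f$; $\delta_s$ is the principal ultrafilter at $s$; for ultrafilters $\nu_s$ on $T$ ($s\in S$) and $\mu$ on $S$, $\int_S\nu_s\,d\mu=\{U\subseteq T:\{s:U\in\nu_s\}\in\mu\}$. $\iota_i:X_i\to\coprod_I X_i$ are the inclusions, and $\iota_i\lambda_i$ the pushforwards. For sets $S_i$, $\int_I S_i\,d\mu=\varinjlim_{U\in\mu}\prod_{i\in U}S_i$, with elements written $[s_i]$. The symbol $*$ denotes the one-point set and its unique ultrafilter. **Ultracategory (Lurie).** A category $\mathcal A$ with: functors $\int_I(-)\,d\mu:\mathcal A^I\to\mathcal A$ for every set $I$ and ultrafilter $\mu$ on $I$; natural isomorphisms $\epsilon_{I,i_0}:\int_I M_i\,d\delta_{i_0}\to M_{i_0}$; natural maps (categorical Fubini transforms) $\Delta_{\mu,\nu_\bullet}:\int_T M_t\,d(\int_S\nu_s d\mu)\to\int_S\int_T M_t\,d\nu_s\,d\mu$; such that (A) $\Delta_{\delta_{s_0},\nu_\bullet}$ is inverse to $\epsilon_{S,s_0}$; (B) for every injection $f:S\to T$, $\Delta_{\mu,\delta_{f(\bullet)}}$ is an isomorphism; (C) for ultrafilters $\lambda$ on $R$, $\mu_r$ on $S$, $\nu_s$ on $T$: $(\int_R\Delta_{\mu_r,\nu_\bullet}d\lambda)\circ\Delta_{\lambda,\int_S\nu_s d\mu_\bullet}=\Delta_{\lambda,\mu_\bullet}\circ\Delta_{\int_R\mu_r d\lambda,\nu_\bullet}$.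 For $f:S\to T$ the ultraproduct diagonal map is $\Delta_{\mu,f}:=(\int_S\epsilon_{T,f(s)}d\mu)\circ\Delta_{\mu,\delta_{f(\bullet)}}:\int_T M_t\,d(f\mu)\to\int_S M_{f(s)}\,d\mu$. The colax associator is the composite $a:\int_{\coprod_S T_s}M_{(s,t)}\,d\int_S\iota_s\gamma_s d\mu\to\int_S\int_{\coprod_S T_s}M_{(s,t)}\,d\iota_s\gamma_s\,d\mu\to\int_S\int_{T_s}M_{(s,t)}\,d\gamma_s\,d\mu$ of a Fubini transform and the ultraproduct of the diagonal maps $\Delta_{\gamma_s,\iota_s}$. The ultracategory is a $T$-pseudo-algebra iff every $a$ is invertible. For $[g_i]\in\int_I\mathrm{Hom}(A_i,B_i)\,d\mu$ represented by $(g_i)_{i\in U}$, $U\in\mu$, $\int_I g_i\,d\mu$ denotes the composite $\int_I A_i d\mu\cong\int_U A_i d\mu\to\int_U B_i d\mu\cong\int_I B_i d\mu$, the isomorphisms being the diagonal maps of $U\hookrightarrow I$. **Generalised ultracategory.** Data: a class of objects; for each object $A$, family of objects $(M_i)_{i\in I}$ and ultrafilter $\mu$ on $I$, a set $\mathrm{Hom}(A,\int_I M_i\,d\mu)$ (a formal symbol); maps $$\beta:\mathrm{Hom}(A,\textstyle\int_I M_i d\mu)\times\int_I\mathrm{Hom}(M_i,\int_{X_i}N_{(i,x)}d\lambda_i)\,d\mu\to\mathrm{Hom}(A,\int_{\coprod_I X_i}N_{(i,x)}\,d\int_I\iota_i\lambda_i d\mu);$$ for $f:J\to I$ and an ultrafilter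 $\mu$ on $J$, maps $\Xi_{f,\mu}:\mathrm{Hom}(A,\int_I M_i\,d f\mu)\to\mathrm{Hom}(A,\int_J M_{f(j)}\,d\mu)$ (written $\Xi_f$); and elements $\kappa_A\in\mathrm{Hom}(A,\int_*A\,d* )$. Axioms: 1. $\Xi_{\mathrm{id}}=\mathrm{id}$. 2. $\Xi_{f,\mu}$ is bijective if $f$ is injective. 3. $\Xi_{f\circ g}=\Xi_g\circ\Xi_f$. 4. $h\mapsto\beta(\kappa_A,[h])$ is inverse to $\Xi_{f_I,\mu}$, where $f_I:I\cong\coprod_* I$. 5. $h\mapsto\beta(h,[\kappa_{M_i}])$ is inverse to $\Xi_{g_I,\mu}$, where $g_I:I\cong\coprod_I *$. 6. (a) For $f_i:K_i\to X_i$, $\lambda_i$ ultrafilters on $K_i$, and $\bar f:\coprod K_i\to\coprod X_i$ induced by the $f_i$: $\Xi_{\bar f}\beta(h,[g_i])=\beta(h,[\Xi_{f_i,\lambda_i}g_i])$. (b) For $f:J\to I$, $\mu$ on $J$, and $\tilde f:\coprod_J X_{f(j)}\to\coprod_I X_i$, $\tilde f(j,x)=(f(j),x)$: $\Xi_{\tilde f}\beta(h,[g_i])=\beta(\Xi_f h,[g_{f(j)}])$. 7. For $f\in\mathrm{Hom}(A,\int_I M_i d\mu)$, $g_i\in\mathrm{Hom}(M_i,\int_{X_i}N_{(i,x)}d\lambda_i)$, $h_{(i,x)}\in\mathrm{Hom}(N_{(i,x)},\int_{T_{(i,x)}}L_{(i,x,t)}d\omega_{(i,x)})$: $\Xi_\theta\,\beta(f,[\beta(g_i,[h_{(i,x)}]_x)]_i)=\beta(\beta(f,[g_i]),[h_{(i,x)}]_{(i,x)})$,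 where $\theta$ is the canonical bijection between $\coprod_I\coprod_{X_i}T_{(i,x)}$ and $\coprod_{\coprod_I X_i}T_{(i,x)}$. *)

(* Defs.v *)
From mathcomp Require Export all_boot.
From mathcomp Require Export boolp classical_sets filter.
From Stdlib Require Import StrictProp.

Set Implicit Arguments.
Unset Strict Implicit.
Unset Printing Implicit Defensive.

Local Open Scope classical_set_scope.
Local Open Scope quotient_scope.

(* Bundled MathComp ultrafilters.  The proof component is squashed into SProp
   (nothing is lost, see [ultraP]), so two ultrafilters whose underlying set
   systems are convertible are convertible.  In particular
     f (g mu) and (f \o g) mu,   id mu and mu,
     \int_S nu_s d(delta_s0) and nu_s0,
     \int_S delta_(f s) dmu and f mu,
     \int_R \int_S nu_s dmu_r dlam and \int_S nu_s d(\int_R mu_r dlam)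
   are convertible, and no transport is needed where one usually identifies
   these ultrafilters silently. *)
Set Primitive Projections.
Record ultrafilter (T : Type) := Ultrafilter {
  ultra_sets :> set T -> Prop;
  ultra_squash : Squash (UltraFilter ultra_sets) }.
Unset Primitive Projections.

Lemma ultraP (T : Type) (mu : ultrafilter T) :
  UltraFilter (ultra_sets mu).
Proof.
apply: contrapT => nmu.
refine (sEmpty_ind (fun=> False) _).
exact (match ultra_squash mu with squash h => match nmu h with end end).
Qed.

Lemma eq_ultra (T : Type) (mu nu : ultrafilter T) :
  (forall A, mu A <-> nu A) -> mu = nu.
Proof.
case: mu nu => [F hF] [G hG] /= FG.
by have E : F = G by [apply/predeqP]; case: G / E {FG} hG.
Qed.

Lemma ultraT (T : Type) (mu : ultrafilter T) : mu setT.
Proof. by have := ultraP mu => muP; apply: filterT. Qed.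

Lemma ultraI (T : Type) (mu : ultrafilter T) (A B : set T) :
  mu A -> mu B -> mu (A `&` B).
Proof. by have := ultraP mu => muP; apply: filterI. Qed.

Lemma ultraS (T : Type) (mu : ultrafilter T) (A B : set T) :
  A `<=` B -> mu A -> mu B.
Proof. by have := ultraP mu => muP; apply: filterS. Qed.

Lemma ultra0 (T : Type) (mu : ultrafilter T) : ~ mu set0.
Proof. by have [[]] := ultraP mu. Qed.

Lemma ultraC (T : Type) (mu : ultrafilter T) (A : set T) :
  mu A \/ mu (~` A).
Proof. by have := ultraP mu => muP; apply: in_ultra_setVsetC. Qed.

Lemma is_ultra (T : Type) (F : set_system T) :
  F setT -> ~ F set0 -> (forall A B, F A -> F B -> F (A `&` B)) ->
  (forall A B, A `<=` B -> F A -> F B) -> (forall A, F A \/ F (~` A)) ->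
  UltraFilter F.
Proof.
move=> FT F0 FI FS FC; split=> [|G GP FG]; first by split.
rewrite predeqE => A; split => [GA|]; last exact: FG.
have [//|/FG GCA] := FC A.
have : G (A `&` ~` A) by apply: filterI.
by rewrite setICr => /(@filter_not_empty _ _ GP).
Qed.

Lemma ultra_map_subproof (S T : Type) (f : S -> T) (mu : ultrafilter S) :
  UltraFilter (fmap f (ultra_sets mu)).
Proof.
apply: is_ultra => /=.
- exact: ultraT.
- exact: ultra0.
- by move=> A B; exact: ultraI.
- by move=> A B AB; apply: ultraS => s; exact: AB.
- by move=> A; exact: ultraC.
Qed.

Definition ultra_map (S T : Type) (f : S -> T) (mu : ultrafilter S) :
  ultrafilter T := Ultrafilter (squash (ultra_map_subproof f mu)).

Lemma dirac_subproof (S : Type) (s : S) : UltraFilter [set U : set S | U s].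
Proof.
apply: is_ultra => //=.
- by move=> A B AB; exact: AB.
- by move=> A; exact: EM.
Qed.

(* Same sets as [principal_filter s], in the form that makes the conversions
   above hold. *)
Definition dirac (S : Type) (s : S) : ultrafilter S :=
  Ultrafilter (squash (dirac_subproof s)).

Lemma diracE (S : Type) (s : S) : dirac s = principal_filter s :> (set S -> Prop).
Proof. by apply/predeqP => U; rewrite principal_filterP. Qed.

Lemma ultra_int_subproof (S T : Type) (mu : ultrafilter S)
    (nu : S -> ultrafilter T) :
  UltraFilter [set U : set T | mu [set s | nu s U]].
Proof.
apply: is_ultra => /=.
- by apply: ultraS (ultraT mu) => s _; exact: ultraT.
- by move=> H; apply: (@ultra0 _ mu); apply: ultraS H => s; exact: ultra0.
- move=> A B HA HB; apply: ultraS (ultraI HA HB) => s [].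
  exact: ultraI.
- by move=> A B AB; apply: ultraS => s; exact: ultraS.
- move=> A; have [|H] := ultraC mu [set s | nu s A]; first by left.
  by right; apply: ultraS H => s nA; have [|//] := ultraC (nu s) A.
Qed.

Definition ultra_int (S T : Type) (mu : ultrafilter S)
    (nu : S -> ultrafilter T) : ultrafilter T :=
  Ultrafilter (squash (ultra_int_subproof mu nu)).

(* [\int_S iota_s gam_s dmu] on [\coprod_S T_s] *)
Definition ultra_sum (S : Type) (T : S -> Type) (mu : ultrafilter S)
    (gam : forall s, ultrafilter (T s)) : ultrafilter {s : S & T s} :=
  ultra_int mu (fun s => ultra_map (existT T s) (gam s)).

Lemma ultra_restr_subproof (S : Type) (mu : ultrafilter S) (U : set S) :
  mu U -> UltraFilter (subset_filter (ultra_sets mu) U).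
Proof.
move=> muU; rewrite /subset_filter; apply: is_ultra => /=.
- by apply: ultraS (ultraT mu) => s _ Us.
- by move=> H; apply: (@ultra0 _ mu); apply: ultraS (ultraI muU H) => s [Us /(_ Us)].
- move=> A B HA HB; apply: ultraS (ultraI HA HB) => s [hA hB] Us.
  by split; [exact: hA | exact: hB].
- by move=> A B AB; apply: ultraS => s hA Us; exact/AB/hA.
- move=> A; have [|H] := ultraC mu [set s | forall Us : U s, A (exist _ s Us)].
    by left.
  right; apply: ultraS H => s nA Us AU; apply: nA => Us'.
  by rewrite (Prop_irrelevance Us' Us).
Qed.

(* The ultrafilter induced by mu on a member U, seen as the type {s | U s}. *)
Definition ultra_restr (S : Type) (mu : ultrafilter S) (U : set S)
    (muU : mu U) : ultrafilter {s | U s} :=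
  Ultrafilter (squash (ultra_restr_subproof muU)).

Lemma ultra_restrK (S : Type) (mu : ultrafilter S) (U : set S) (muU : mu U) :
  ultra_map sval (ultra_restr muU) = mu.
Proof.
apply: eq_ultra => A; split => /= H.
  by apply: ultraS (ultraI muU H) => s [Us]; exact.
by apply: ultraS H => s As Us.
Qed.

(* A pair of U \in mu and an element of \prod_(i in U) S_i. *)
Record partial_family (I : Type) (mu : ultrafilter I) (S : I -> Type) :=
  PartialFamily {
    pf_dom : set I;
    pf_domP : mu pf_dom;
    pf_val : forall u : {i | pf_dom i}, S (sval u) }.

Definition same_germ (I : Type) (mu : ultrafilter I) (S : I -> Type)
    (r s : partial_family mu S) : Prop :=
  exists2 V : set I, mu V &
    forall i, V i -> exists (ri : pf_dom r i) (si : pf_dom s i),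
      pf_val (exist _ i ri) = pf_val (exist _ i si).

Definition same_germb (I : Type) (mu : ultrafilter I) (S : I -> Type)
    (r s : {classic partial_family mu S}) : bool := `[< same_germ r s >].

Lemma same_germ_refl (I : Type) (mu : ultrafilter I) (S : I -> Type) :
  reflexive (@same_germb I mu S).
Proof.
move=> r; apply/asboolP; exists (pf_dom r); first exact: pf_domP.
by move=> i ri; exists ri, ri.
Qed.

Lemma same_germ_sym (I : Type) (mu : ultrafilter I) (S : I -> Type) :
  symmetric (@same_germb I mu S).
Proof.
move=> r s; apply/asboolP/asboolP => -[V muV H]; exists V => // i /H [a [b e]].
  by exists b, a.
by exists b, a.
Qed.

Lemma same_germ_trans (I : Type) (mu : ultrafilter I) (S : I -> Type) :
  transitive (@same_germb I mu S).
Proof.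
move=> s r t /asboolP [V muV rs] /asboolP [W muW st]; apply/asboolP.
exists (V `&` W); first exact: ultraI.
move=> i [/rs [ri [si e]] /st [si' [ti e']]]; exists ri, ti.
by rewrite e (Prop_irrelevance si si').
Qed.

Definition germ_equiv (I : Type) (mu : ultrafilter I) (S : I -> Type) :
    equiv_rel {classic partial_family mu S} :=
  EquivRel (@same_germb I mu S) (@same_germ_refl I mu S)
    (@same_germ_sym I mu S) (@same_germ_trans I mu S).

(* [\int_I S_i dmu]: the filtered colimit, over U \in mu ordered by reverse
   inclusion, of \prod_(i in U) S_i. *)
Definition ultraproduct (I : Type) (mu : ultrafilter I) (S : I -> Type) :
  Type := {eq_quot germ_equiv mu S}.

Definition germ (I : Type) (mu : ultrafilter I) (S : I -> Type)
    (r : partial_family mu S) : ultraproduct mu S :=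
  \pi_({eq_quot germ_equiv mu S}) (r : {classic partial_family mu S}).

Lemma germP (I : Type) (mu : ultrafilter I) (S : I -> Type)
    (r s : partial_family mu S) : germ r = germ s <-> same_germ r s.
Proof.
rewrite /germ; split => [/eqmodP /asboolP //|rs].
by apply/eqmodP/asboolP.
Qed.

Lemma germ_surj (I : Type) (mu : ultrafilter I) (S : I -> Type)
    (x : ultraproduct mu S) : exists r, x = germ r.
Proof. by exists (repr x); rewrite /germ reprK. Qed.

Definition pf_total (I : Type) (mu : ultrafilter I) (S : I -> Type)
    (s : forall i, S i) : partial_family mu S :=
  PartialFamily (ultraT mu) (fun u => s (sval u)).

Definition pf_map (I : Type) (mu : ultrafilter I) (S S' : I -> Type)
    (phi : forall i, S i -> S' i) (r : partial_family mu S) :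
    partial_family mu S' :=
  PartialFamily (pf_domP r) (fun u => phi (sval u) (pf_val u)).

(* [(s_i)_i] over f mu gives [(s_(f j))_j] over mu. *)
Definition pf_reindex (I J : Type) (f : J -> I) (mu : ultrafilter J)
    (S : I -> Type) (r : partial_family (ultra_map f mu) S) :
    partial_family mu (fun j => S (f j)) :=
  @PartialFamily J mu (fun j => S (f j)) (f @^-1` pf_dom r) (pf_domP r)
    (fun u => pf_val (exist (pf_dom r) (f (sval u)) (svalP u))).

Record category := Category {
  obj :> Type;
  hom : obj -> obj -> Type;
  idm : forall A, hom A A;
  comp : forall A B C, hom B C -> hom A B -> hom A C;
  comp_idl : forall A B (f : hom A B), comp (idm B) f = f;
  comp_idr : forall A B (f : hom A B), comp f (idm A) = f;
  comp_assoc : forall A B C D (h : hom C D) (g : hom B C) (f : hom A B),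
    comp h (comp g f) = comp (comp h g) f }.

Arguments hom {c} A B.
Arguments idm {c} A.
Arguments comp {c A B C} g f.

Declare Scope cat_scope.
Delimit Scope cat_scope with cat.
Notation "g ∘ f" := (comp g f) (at level 40, left associativity) : cat_scope.
Local Open Scope cat_scope.

Definition inverse_of (C : category) (A B : C) (f : hom A B) (g : hom B A) :=
  g ∘ f = idm A /\ f ∘ g = idm B.

Definition is_iso (C : category) (A B : C) (f : hom A B) :=
  exists g, inverse_of f g.

Definition inv (C : category) (A B : C) (f : hom A B) (fiso : is_iso f) :
  hom B A := projT1 (cid fiso).

Lemma invP (C : category) (A B : C) (f : hom A B) (fiso : is_iso f) :
  inverse_of f (inv fiso).
Proof. exact: projT2 (cid fiso). Qed.

Lemma comp_iso (C : category) (X Y Z : C) (g : hom Y Z) (f : hom X Y) :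
  is_iso g -> is_iso f -> is_iso (g ∘ f).
Proof.
move=> [g' [g'g gg']] [f' [f'f ff']]; exists (f' ∘ g'); split.
  by rewrite -comp_assoc (comp_assoc g') g'g comp_idl.
by rewrite -comp_assoc (comp_assoc f) ff' comp_idl.
Qed.

Record ultracategory := Ultracategory {
  ucat :> category;
  (* the functors [\int_I (-) dmu : A^I -> A] *)
  uprod : forall (I : Type) (mu : ultrafilter I), (I -> ucat) -> ucat;
  uprod_map : forall (I : Type) (mu : ultrafilter I) (M N : I -> ucat),
    (forall i, hom (M i) (N i)) -> hom (uprod mu M) (uprod mu N);
  uprod_map_id : forall (I : Type) (mu : ultrafilter I) (M : I -> ucat),
    uprod_map mu (fun i => idm (M i)) = idm (uprod mu M);
  uprod_map_comp : forall (I : Type) (mu : ultrafilter I) (L M N : I -> ucat)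
      (g : forall i, hom (M i) (N i)) (f : forall i, hom (L i) (M i)),
    uprod_map mu (fun i => g i ∘ f i) = uprod_map mu g ∘ uprod_map mu f;
  eps : forall (I : Type) (i0 : I) (M : I -> ucat),
    hom (uprod (dirac i0) M) (M i0);
  eps_natural : forall (I : Type) (i0 : I) (M N : I -> ucat)
      (f : forall i, hom (M i) (N i)),
    eps i0 N ∘ uprod_map (dirac i0) f = f i0 ∘ eps i0 M;
  eps_iso : forall (I : Type) (i0 : I) (M : I -> ucat), is_iso (eps i0 M);
  (* the categorical Fubini transforms Delta_(mu, nu) *)
  fubini : forall (S T : Type) (mu : ultrafilter S) (nu : S -> ultrafilter T)
      (M : T -> ucat),
    hom (uprod (ultra_int mu nu) M) (uprod mu (fun s => uprod (nu s) M));
  fubini_natural : forall (S T : Type) (mu : ultrafilter S)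
      (nu : S -> ultrafilter T) (M N : T -> ucat)
      (f : forall t, hom (M t) (N t)),
    fubini mu nu N ∘ uprod_map (ultra_int mu nu) f
    = uprod_map mu (fun s => uprod_map (nu s) f) ∘ fubini mu nu M;
  fubini_dirac : forall (S T : Type) (s0 : S) (nu : S -> ultrafilter T)
      (M : T -> ucat),
    inverse_of (eps s0 (fun s => uprod (nu s) M)) (fubini (dirac s0) nu M);
  fubini_inj : forall (S T : Type) (f : S -> T), injective f ->
    forall (mu : ultrafilter S) (M : T -> ucat),
    is_iso (fubini mu (fun s => dirac (f s)) M);
  fubini_assoc : forall (R S T : Type) (lam : ultrafilter R)
      (mu : R -> ultrafilter S) (nu : S -> ultrafilter T) (M : T -> ucat),
    uprod_map lam (fun r => fubini (mu r) nu M)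
      ∘ fubini lam (fun r => ultra_int (mu r) nu) M
    = fubini lam mu (fun s => uprod (nu s) M)
      ∘ fubini (ultra_int lam mu) nu M }.

Arguments uprod {u I} mu M.
Arguments uprod_map {u I} mu {M N} f.
Arguments eps {u I} i0 M.
Arguments fubini {u S T} mu nu M.

(* The ultraproduct diagonal map Delta_(mu, f); its domain is declared as
   [uprod (ultra_map f mu) M] since [ultra_map f mu] is convertible to
   [ultra_int mu (fun s => dirac (f s))]. *)
Definition diag (C : ultracategory) (S T : Type) (f : S -> T)
    (mu : ultrafilter S) (M : T -> C) :
    hom (uprod (ultra_map f mu) M) (uprod mu (fun s => M (f s))) :=
  uprod_map mu (fun s => eps (f s) M) ∘ fubini mu (fun s => dirac (f s)) M.

(* The colax associator.  A family on [\coprod_S T_s] is given in curried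
   form. *)
Definition associator (C : ultracategory) (S : Type) (T : S -> Type)
    (mu : ultrafilter S) (gam : forall s, ultrafilter (T s))
    (M : forall s, T s -> C) :
    hom (uprod (ultra_sum mu gam) (fun p => M (projT1 p) (projT2 p)))
        (uprod mu (fun s => uprod (gam s) (M s))) :=
  let M' := fun p : {s : S & T s} => M (projT1 p) (projT2 p) in
  uprod_map mu (fun s => diag (existT T s) (gam s) M')
    ∘ fubini mu (fun s => ultra_map (existT T s) (gam s)) M'.

Definition is_T_pseudo_algebra (C : ultracategory) : Prop :=
  forall (S : Type) (T : S -> Type) (mu : ultrafilter S)
    (gam : forall s, ultrafilter (T s)) (M : forall s, T s -> C),
  is_iso (associator mu gam M).

Lemma uprod_map_iso (C : ultracategory) (I : Type) (mu : ultrafilter I)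
    (M N : I -> C) (f : forall i, hom (M i) (N i)) :
  (forall i, is_iso (f i)) -> is_iso (uprod_map mu f).
Proof.
move=> fiso; exists (uprod_map mu (fun i => inv (fiso i))).
split; rewrite -uprod_map_comp -uprod_map_id; congr uprod_map;
  by apply: functional_extensionality_dep => i; case: (invP (fiso i)).
Qed.

Lemma diag_iso (C : ultracategory) (S T : Type) (f : S -> T)
    (mu : ultrafilter S) (M : T -> C) :
  injective f -> is_iso (diag f mu M).
Proof.
move=> finj; apply: comp_iso; last exact: fubini_inj.
by apply: uprod_map_iso => s; exact: eps_iso.
Qed.

Lemma sval_inj (I : Type) (U : set I) : injective (@sval I U).
Proof.
by move=> [i Ui] [j Uj] /= ij; case: j / ij Uj => Uj; rewrite (Prop_irrelevance Ui Uj).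
Qed.

(* The diagonal map \int_I M_i dmu -> \int_U M_i dmu of U -> I, for U \in mu;
   the transport identifies mu with the pushforward of its restriction. *)
Definition restr_diag (C : ultracategory) (I : Type) (mu : ultrafilter I)
    (U : set I) (muU : mu U) (M : I -> C) :
    hom (uprod mu M) (uprod (ultra_restr muU) (fun u => M (sval u))) :=
  eq_rect _ (fun rho : ultrafilter I => hom (uprod rho M) _)
    (diag sval (ultra_restr muU) M) _ (ultra_restrK muU).

Lemma restr_diag_iso (C : ultracategory) (I : Type) (mu : ultrafilter I)
    (U : set I) (muU : mu U) (M : I -> C) : is_iso (restr_diag muU M).
Proof.
rewrite /restr_diag; move: (ultra_restr muU) (ultra_restrK muU) => nu E.
case: mu / E {muU} => /=.
exact/diag_iso/sval_inj.
Qed.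

(* [\int_I g_i dmu] computed from a representative of [[g_i]]. *)
Definition uprod_germ (C : ultracategory) (I : Type) (mu : ultrafilter I)
    (M N : I -> C) (g : partial_family mu (fun i => hom (M i) (N i))) :
    hom (uprod mu M) (uprod mu N) :=
  inv (restr_diag_iso (pf_domP g) N)
    ∘ uprod_map (ultra_restr (pf_domP g)) (@pf_val _ _ _ g)
    ∘ restr_diag (pf_domP g) M.

(* Families on [\coprod_I X_i] are curried; [ghom A mu M] is the set
   [Hom(A, \int_I M_i dmu)]. *)
Record gultra_data (Ob : Type) := GUltraData {
  ghom : Ob -> forall I : Type, ultrafilter I -> (I -> Ob) -> Type;
  gbeta : forall (A : Ob) (I : Type) (mu : ultrafilter I) (M : I -> Ob)
      (X : I -> Type) (lam : forall i, ultrafilter (X i))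
      (N : forall i, X i -> Ob),
    ghom A mu M ->
    ultraproduct mu (fun i => ghom (M i) (lam i) (N i)) ->
    ghom A (ultra_sum mu lam) (fun p => N (projT1 p) (projT2 p));
  gxi : forall (A : Ob) (I J : Type) (f : J -> I) (mu : ultrafilter J)
      (M : I -> Ob),
    ghom A (ultra_map f mu) M -> ghom A mu (fun j => M (f j));
  gkappa : forall A : Ob, ghom A (dirac tt) (fun _ : unit => A) }.

Arguments ghom {Ob} g A {I} mu M.
Arguments gbeta {Ob} g {A I mu M X lam} N h k.
Arguments gxi {Ob} g {A I J} f mu M h.
Arguments gkappa {Ob} g A.

Definition unit_sum (I : Type) (i : I) : {_ : unit & I} :=
  existT (fun _ : unit => I) tt i.

Definition sum_unit (I : Type) (i : I) : {_ : I & unit} :=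
  existT (fun _ : I => unit) i tt.

Definition sum_map (I : Type) (K X : I -> Type) (f : forall i, K i -> X i)
    (p : {i & K i}) : {i & X i} :=
  existT X (projT1 p) (f (projT1 p) (projT2 p)).

Definition sum_reindex (I J : Type) (f : J -> I) (X : I -> Type)
    (p : {j & X (f j)}) : {i & X i} :=
  existT X (f (projT1 p)) (projT2 p).

Definition sum_assoc (I : Type) (X : I -> Type) (T : forall i, X i -> Type)
    (q : {p : {i & X i} & T (projT1 p) (projT2 p)}) :
    {i & {x : X i & T i x}} :=
  existT (fun i => {x : X i & T i x}) (projT1 (projT1 q))
    (existT (T (projT1 (projT1 q))) (projT2 (projT1 q)) (projT2 q)).

(* The representative of [[beta(g_i, [h_(i,x)]_x)]_i] given by representatives
   (g_i) and (h_(i,x)): it is defined at i when g_i is and when h_(i,x) is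
   defined for lam_i-almost all x. *)
Definition pf_beta (Ob : Type) (G : gultra_data Ob) (I : Type)
    (mu : ultrafilter I) (M : I -> Ob)
    (X : I -> Type) (lam : forall i, ultrafilter (X i))
    (N : forall i, X i -> Ob)
    (T : forall i, X i -> Type) (om : forall i x, ultrafilter (T i x))
    (L : forall i x, T i x -> Ob)
    (g : partial_family mu (fun i => ghom G (M i) (lam i) (N i)))
    (h : partial_family (ultra_sum mu lam) (fun p =>
       ghom G (N (projT1 p) (projT2 p)) (om (projT1 p) (projT2 p))
         (L (projT1 p) (projT2 p)))) :
    partial_family mu (fun i =>
      ghom G (M i) (ultra_sum (lam i) (om i))
        (fun q => L i (projT1 q) (projT2 q))) :=
  @PartialFamily I mu _
    (pf_dom g `&` [set i | lam i [set x | pf_dom h (existT X i x)]])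
    (ultraI (pf_domP g) (pf_domP h))
    (fun u => gbeta G (L (sval u))
       (pf_val (exist (pf_dom g) (sval u) (proj1 (svalP u))))
       (germ (@PartialFamily (X (sval u)) (lam (sval u))
          (fun x => ghom G (N (sval u) x) (om (sval u) x) (L (sval u) x))
          [set x | pf_dom h (existT X (sval u) x)] (proj2 (svalP u))
          (fun w => pf_val
             (exist (pf_dom h) (existT X (sval u) (sval w)) (svalP w)))))).

Record gultra_axioms (Ob : Type) (G : gultra_data Ob) : Prop := GUltraAxioms {
  gxi_id : forall (A : Ob) (I : Type) (mu : ultrafilter I) (M : I -> Ob)
      (h : ghom G A mu M),
    gxi G id mu M h = h;
  gxi_inj : forall (A : Ob) (I J : Type) (f : J -> I) (mu : ultrafilter J)
      (M : I -> Ob),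
    injective f -> bijective (gxi G f mu M : ghom G A (ultra_map f mu) M -> _);
  gxi_comp : forall (A : Ob) (I J K : Type) (f : J -> I) (g : K -> J)
      (mu : ultrafilter K) (M : I -> Ob) (h : ghom G A (ultra_map (f \o g) mu) M),
    gxi G (f \o g) mu M h
    = gxi G g mu (fun j => M (f j)) (gxi G f (ultra_map g mu) M h);
  gbeta_kappal : forall (A : Ob) (I : Type) (mu : ultrafilter I) (M : I -> Ob),
    let beta_kappa (h : ghom G A mu M) :
        ghom G A (ultra_map (@unit_sum I) mu) (fun p => M (projT2 p)) :=
      gbeta G (fun _ : unit => M) (gkappa G A)
        (germ (pf_total (dirac tt) (fun _ : unit => h))) in
    let xi := gxi G (@unit_sum I) mu (fun p => M (projT2 p)) in
    cancel beta_kappa xi /\ cancel xi beta_kappa;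
  gbeta_kappar : forall (A : Ob) (I : Type) (mu : ultrafilter I) (M : I -> Ob),
    let beta_kappa (h : ghom G A mu M) :
        ghom G A (ultra_map (@sum_unit I) mu) (fun p => M (projT1 p)) :=
      gbeta G (fun (i : I) (_ : unit) => M i) h
        (germ (pf_total mu (fun i => gkappa G (M i)))) in
    let xi := gxi G (@sum_unit I) mu (fun p => M (projT1 p)) in
    cancel beta_kappa xi /\ cancel xi beta_kappa;
  gbeta_xil : forall (A : Ob) (I : Type) (mu : ultrafilter I) (M : I -> Ob)
      (K X : I -> Type) (f : forall i, K i -> X i)
      (lam : forall i, ultrafilter (K i)) (N : forall i, X i -> Ob)
      (h : ghom G A mu M)
      (g : partial_family mu
         (fun i => ghom G (M i) (ultra_map (f i) (lam i)) (N i))),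
    gxi G (sum_map f) (ultra_sum mu lam) (fun p => N (projT1 p) (projT2 p))
      (gbeta G N h (germ g))
    = gbeta G (fun i k => N i (f i k)) h
        (germ (pf_map (fun i => gxi G (f i) (lam i) (N i)) g));
  gbeta_xir : forall (A : Ob) (I J : Type) (f : J -> I) (mu : ultrafilter J)
      (M : I -> Ob) (X : I -> Type) (lam : forall i, ultrafilter (X i))
      (N : forall i, X i -> Ob) (h : ghom G A (ultra_map f mu) M)
      (g : partial_family (ultra_map f mu)
         (fun i => ghom G (M i) (lam i) (N i))),
    gxi G (@sum_reindex I J f X) (ultra_sum mu (fun j => lam (f j)))
      (fun p => N (projT1 p) (projT2 p)) (gbeta G N h (germ g))
    = gbeta G (fun j => N (f j)) (gxi G f mu M h) (germ (pf_reindex g));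
  gbeta_assoc : forall (A : Ob) (I : Type) (mu : ultrafilter I) (M : I -> Ob)
      (X : I -> Type) (lam : forall i, ultrafilter (X i))
      (N : forall i, X i -> Ob)
      (T : forall i, X i -> Type) (om : forall i x, ultrafilter (T i x))
      (L : forall i x, T i x -> Ob)
      (f : ghom G A mu M)
      (g : partial_family mu (fun i => ghom G (M i) (lam i) (N i)))
      (h : partial_family (ultra_sum mu lam) (fun p =>
         ghom G (N (projT1 p) (projT2 p)) (om (projT1 p) (projT2 p))
           (L (projT1 p) (projT2 p)))),
    gxi G (@sum_assoc I X T)
      (ultra_sum (ultra_sum mu lam) (fun p => om (projT1 p) (projT2 p)))
      (fun r => L (projT1 r) (projT1 (projT2 r)) (projT2 (projT2 r)))
      (gbeta G (fun i q => L i (projT1 q) (projT2 q)) f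
         (germ (pf_beta g h)))
    = gbeta G (fun p => L (projT1 p) (projT2 p)) (gbeta G N f (germ g))
        (germ h) }.

Definition sub_ghom (C : ultracategory) (B : set C) (A : {X : C | B X})
    (I : Type) (mu : ultrafilter I) (M : I -> {X : C | B X}) : Type :=
  hom (sval A) (uprod mu (fun i => sval (M i))).

(* [a^-1 \o (\int_I g_i dmu) \o f], from a representative of [[g_i]] *)
Definition sub_gbeta_rep (C : ultracategory) (B : set C)
    (aiso : is_T_pseudo_algebra C) (A : {X : C | B X}) (I : Type)
    (mu : ultrafilter I) (M : I -> {X : C | B X})
    (X : I -> Type) (lam : forall i, ultrafilter (X i))
    (N : forall i, X i -> {X : C | B X})
    (f : sub_ghom A mu M)
    (g : partial_family mu (fun i => sub_ghom (M i) (lam i) (N i))) :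
    sub_ghom A (ultra_sum mu lam) (fun p => N (projT1 p) (projT2 p)) :=
  inv (aiso I X mu lam (fun i x => sval (N i x)))
    ∘ uprod_germ (M := fun i => sval (M i))
        (N := fun i => uprod (lam i) (fun x => sval (N i x))) g
    ∘ f.

Definition sub_gxi (C : ultracategory) (B : set C) (A : {X : C | B X})
    (I J : Type) (f : J -> I) (mu : ultrafilter J) (M : I -> {X : C | B X})
    (h : sub_ghom A (ultra_map f mu) M) : sub_ghom A mu (fun j => M (f j)) :=
  diag f mu (fun i => sval (M i)) ∘ h.

Definition sub_gkappa (C : ultracategory) (B : set C) (A : {X : C | B X}) :
    sub_ghom A (dirac tt) (fun _ : unit => A) :=
  inv (eps_iso tt (fun _ : unit => sval A)).

(* Main.v *)
Require Import Defs.

(** Morphisms A -> \int_I M_i dmu of an ultracategory form a generalised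
    ultrastructure because each axiom, once the inverse associators are moved
    to the other side, becomes a statement about the maps
    \int_T -> \int_S \int_(T_s) alone.  Those statements follow from
    the naturality and associativity of the Fubini transforms and from their
    values over principal ultrafilters.

    The common form of these maps is [fubini_along]: a Fubini transform along
    the ultrafilters f_s gam_s on a fixed set U, for maps f_s : T_s -> U,
    followed by the ultraproduct of the diagonal maps of the f_s.  The
    associator is the case U = \coprod_S T_s.  Keeping U and the f_s arbitrary
    makes the family stable under every change of index set, with one law per
    place where a map can be inserted: in the sources T_s
    ([fubini_along_source]), in the target U ([fubini_along_target]) and in
    the outer index set S ([fubini_along_reindex]).  Combining two of them
    gives the compatibility of beta with Xi at the level of associators, and
    together with [fubini_along_comp], which is the associativity of Fubini
    transforms, it gives the pentagon [associator_pentagon], hence the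
    associativity of beta.  The axioms on Xi alone are the functoriality and
    invertibility of diagonal maps, and the two unit laws are the identities
    [diag_unit_sum] and [diag_sum_unit].

    The remaining point is that the g_i are only defined almost everywhere, and
    need not extend to total families since hom sets may be empty.  Partial
    families are reduced to total ones by restricting the ultrafilter: a
    member V of mu makes mu the image of an ultrafilter on V, and the diagonal
    map of V -> I is invertible, so equations between ultraproducts over I may
    be checked over V.  There [diag_uprod_germ_total] replaces the ultraproduct
    of the germ by an honest ultraproduct of morphisms.  This yields
    functoriality ([uprod_germ_comp]), compatibility with reindexing
    ([diag_uprod_germ]) and naturality of the associator with respect to germs
    ([fubini_along_germ]). *)

Local Open Scope cat_scope.

(** * Morphisms and ultraproducts of morphisms *)

Lemma eq_uprod_map {C : ultracategory} {I : Type} (mu : ultrafilter I)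
    {M N : I -> C} (f g : forall i, hom (M i) (N i)) :
  (forall i, f i = g i) -> uprod_map mu f = uprod_map mu g.
Proof. by move=> fg; congr uprod_map; apply: functional_extensionality_dep. Qed.

Lemma is_iso_monic {C : category} {X Y Z : C} {k : hom Y Z} {f g : hom X Y} :
  is_iso k -> k ∘ f = k ∘ g -> f = g.
Proof.
move=> [k' [k'k _]] kfg.
by rewrite -(comp_idl f) -k'k -comp_assoc kfg comp_assoc k'k comp_idl.
Qed.

(** * Diagonal maps and Fubini transforms *)

Lemma diag_natural {C : ultracategory} {S T : Type} (f : S -> T)
    (mu : ultrafilter S)
    {M N : T -> C} (g : forall t, hom (M t) (N t)) :
  diag f mu N ∘ uprod_map (ultra_map f mu) g
  = uprod_map mu (fun s => g (f s)) ∘ diag f mu M.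
Proof.
rewrite /diag -comp_assoc.
rewrite [X in _ ∘ X = _](fubini_natural mu (fun s => dirac (f s)) g).
rewrite !comp_assoc -!uprod_map_comp; congr comp; apply: eq_uprod_map => s.
exact: eps_natural.
Qed.

(** Associativity with the inner family of ultrafilters delta_(g r): the
    Fubini transforms over delta_(g r) cancel against the maps [eps] that the
    diagonal map of g contains. *)
Lemma fubini_reindex {C : ultracategory} {R S T : Type} (g : R -> S)
    (mu : ultrafilter R)
    (nu : S -> ultrafilter T) (M : T -> C) :
  fubini mu (fun r => nu (g r)) M
  = diag g mu (fun s => uprod (nu s) M) ∘ fubini (ultra_map g mu) nu M.
Proof.
rewrite /diag -comp_assoc.
rewrite -[X in _ = _ ∘ X](fubini_assoc mu (fun r => dirac (g r)) nu M).
rewrite comp_assoc -uprod_map_comp.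
rewrite [X in X ∘ _](_ : _ = idm _) ?comp_idl // -uprod_map_id.
apply: eq_uprod_map => r; exact: (fubini_dirac (g r) nu M).2.
Qed.

(** Associativity with the innermost family of ultrafilters delta_(f t). *)
Lemma diag_fubini {C : ultracategory} {S T U : Type} (f : T -> U)
    (mu : ultrafilter S)
    (nu : S -> ultrafilter T) (M : U -> C) :
  uprod_map mu (fun s => diag f (nu s) M)
    ∘ fubini mu (fun s => ultra_map f (nu s)) M
  = fubini mu nu (fun t => M (f t)) ∘ diag f (ultra_int mu nu) M.
Proof.
rewrite /diag uprod_map_comp -comp_assoc.
rewrite [X in _ ∘ X = _](fubini_assoc mu nu (fun t => dirac (f t)) M).
by rewrite !comp_assoc fubini_natural.
Qed.

(** Since delta_(f (g r)) is the value at g r of the family delta_(f s), this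
    is a case of [fubini_reindex], completed by naturality. *)
Lemma diag_comp {C : ultracategory} {R S T : Type} (f : S -> T) (g : R -> S)
    (mu : ultrafilter R)
    (M : T -> C) :
  diag (fun r => f (g r)) mu M
  = diag g mu (fun s => M (f s)) ∘ diag f (ultra_map g mu) M.
Proof.
rewrite [X in _ = _ ∘ X]/diag comp_assoc diag_natural -comp_assoc.
by rewrite -[X in _ = _ ∘ X](fubini_reindex g mu (fun s => dirac (f s))).
Qed.

(** The map is idempotent by [diag_comp] and invertible since the identity is
    injective. *)
Lemma diag_id {C : ultracategory} {I : Type} (mu : ultrafilter I) (M : I -> C) :
  diag (fun i => i) mu M = idm (uprod mu M).
Proof.
have iso : is_iso (diag (fun i => i) mu M) by apply: diag_iso.
apply: (is_iso_monic iso); rewrite comp_idr.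
by rewrite -[LHS]diag_comp.
Qed.

Lemma eps_diag {C : ultracategory} {S T : Type} (f : S -> T) (s : S)
    (M : T -> C) :
  eps s (fun s => M (f s)) ∘ diag f (dirac s) M = eps (f s) M.
Proof.
rewrite /diag comp_assoc eps_natural -comp_assoc.
by rewrite [X in _ ∘ X = _](fubini_dirac s (fun s => dirac (f s)) M).2 comp_idr.
Qed.

(** The associator with the coproduct replaced by any set U receiving the
    T_s.  Its laws are stated with U and f free because reindexing a coproduct
    turns the inclusions [existT] into other maps. *)
Definition fubini_along {C : ultracategory} {S : Type} {T : S -> Type}
    {U : Type}
    (mu : ultrafilter S) (f : forall s, T s -> U)
    (gam : forall s, ultrafilter (T s)) (M : U -> C) :
    hom (uprod (ultra_int mu (fun s => ultra_map (f s) (gam s))) M)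
        (uprod mu (fun s => uprod (gam s) (fun t => M (f s t)))) :=
  uprod_map mu (fun s => diag (f s) (gam s) M)
    ∘ fubini mu (fun s => ultra_map (f s) (gam s)) M.

Lemma fubini_along_natural {C : ultracategory} {S : Type} {T : S -> Type}
    {U : Type}
    (mu : ultrafilter S) (f : forall s, T s -> U)
    (gam : forall s, ultrafilter (T s)) {M N : U -> C}
    (g : forall u, hom (M u) (N u)) :
  fubini_along mu f gam N ∘ uprod_map _ g
  = uprod_map mu (fun s => uprod_map (gam s) (fun t => g (f s t)))
      ∘ fubini_along mu f gam M.
Proof.
rewrite /fubini_along -comp_assoc fubini_natural !comp_assoc -!uprod_map_comp.
by congr comp; apply: eq_uprod_map => s; exact: diag_natural.
Qed.

Lemma fubini_along_source {C : ultracategory} {S : Type} {K T : S -> Type}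
    {U : Type}
    (mu : ultrafilter S) (f : forall s, T s -> U) (k : forall s, K s -> T s)
    (gam : forall s, ultrafilter (K s)) (M : U -> C) :
  fubini_along mu (fun s t => f s (k s t)) gam M
  = uprod_map mu (fun s => diag (k s) (gam s) (fun t => M (f s t)))
      ∘ fubini_along mu f (fun s => ultra_map (k s) (gam s)) M.
Proof.
rewrite /fubini_along comp_assoc -uprod_map_comp; congr comp.
by apply: eq_uprod_map => s; exact: diag_comp.
Qed.

Lemma fubini_along_target {C : ultracategory} {S : Type} {T : S -> Type}
    {U V : Type}
    (mu : ultrafilter S) (h : U -> V) (f : forall s, T s -> U)
    (gam : forall s, ultrafilter (T s)) (M : V -> C) :
  fubini_along mu (fun s t => h (f s t)) gam M
  = fubini_along mu f gam (fun u => M (h u)) ∘ diag h _ M.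
Proof.
rewrite [in RHS]/fubini_along -comp_assoc.
rewrite -[X in _ = _ ∘ X](diag_fubini h mu (fun s => ultra_map (f s) (gam s))).
rewrite comp_assoc -uprod_map_comp /fubini_along; congr comp.
by apply: eq_uprod_map => s; exact: diag_comp.
Qed.

Lemma fubini_along_reindex {C : ultracategory} {R S : Type} {T : S -> Type}
    {U : Type} (g : R -> S)
    (mu : ultrafilter R) (f : forall s, T s -> U)
    (gam : forall s, ultrafilter (T s)) (M : U -> C) :
  fubini_along mu (fun r => f (g r)) (fun r => gam (g r)) M
  = diag g mu (fun s => uprod (gam s) (fun t => M (f s t)))
      ∘ fubini_along (ultra_map g mu) f gam M.
Proof.
rewrite /fubini_along [RHS]comp_assoc.
rewrite [X in _ = X ∘ _](diag_natural g mu (fun s => diag (f s) (gam s) M)).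
rewrite -[RHS]comp_assoc; congr comp.
exact: (fubini_reindex g mu (fun s => ultra_map (f s) (gam s))).
Qed.

(** Decomposing \int_U first over \coprod_I X_i and then over I is the same as
    decomposing it first over I and then over each X_i.  This is the
    associativity of Fubini transforms with the iterated ultrafilters
    \int_(X_i) h om dlam_i, whose middle step has been reindexed along the
    inclusions X_i -> \coprod_I X_i. *)
Lemma fubini_along_comp {C : ultracategory} {I : Type} {X : I -> Type}
    {T : {i & X i} -> Type}
    {U : Type} (mu : ultrafilter I) (lam : forall i, ultrafilter (X i))
    (h : forall p, T p -> U) (om : forall p, ultrafilter (T p)) (M : U -> C) :
  fubini_along mu (existT X) lam
      (fun p => uprod (om p) (fun t => M (h p t)))
    ∘ fubini_along (ultra_sum mu lam) h om M
  = uprod_map mu (fun i => fubini_along (lam i) (fun x => h (existT X i x))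
      (fun x => om (existT X i x)) M)
    ∘ fubini mu (fun i => ultra_int (lam i)
        (fun x => ultra_map (h (existT X i x)) (om (existT X i x)))) M.
Proof.
pose nu p := ultra_map (h p) (om p).
rewrite [X in _ ∘ X = _]/fubini_along comp_assoc fubini_along_natural.
rewrite /fubini_along uprod_map_comp -!comp_assoc; congr comp.
rewrite [X in _ ∘ X = _](_ : _
  = fubini mu (fun i => ultra_map (existT X i) (lam i))
      (fun p => uprod (nu p) M) ∘ fubini (ultra_sum mu lam) nu M) //.
rewrite -[X in _ ∘ X = _](fubini_assoc mu
  (fun i => ultra_map (existT X i) (lam i)) nu M).
rewrite comp_assoc -uprod_map_comp; congr comp; apply: eq_uprod_map => i.
by rewrite -(fubini_reindex (existT X i) (lam i) nu M).
Qed.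

(** * Ultraproducts of germs of morphisms *)

Lemma pf_val_irrelevance {I : Type} {mu : ultrafilter I} {S : I -> Type}
    (g : partial_family mu S) (i : I) (gi gi' : pf_dom g i) :
  pf_val (exist (pf_dom g) i gi) = pf_val (exist (pf_dom g) i gi').
Proof. by rewrite (Prop_irrelevance gi gi'). Qed.

(** In this form, [mu] can be eliminated by substitution, and [restr_diag]
    becomes a plain diagonal map without transport. *)
Lemma ultra_restrict {I : Type} (mu : ultrafilter I) (U : set I) :
  mu U -> exists nu : ultrafilter {i | U i}, mu = ultra_map sval nu.
Proof. by move=> muU; exists (ultra_restr muU); rewrite ultra_restrK. Qed.

Lemma ultra_map_sval_inj {I : Type} (U : set I) :
  injective (@ultra_map {i | U i} I sval).
Proof.
move=> rho sig E; apply: eq_ultra => A.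
pose B i := exists Ui : U i, A (exist U i Ui).
have -> : A = (sval @^-1` B)%classic.
  apply/predeqP => -[i Ui] /=; split=> [|[Ui']]; first by exists Ui.
  by rewrite (Prop_irrelevance Ui Ui').
by change (ultra_map sval rho B <-> ultra_map sval sig B); rewrite E.
Qed.

(** The defining property of [uprod_germ], with the inclusion of the domain
    replaced by any map that lands in the domain.  Such an f factors through
    the inclusion, and [diag_comp] splits its diagonal map accordingly. *)
Lemma diag_uprod_germ_total {C : ultracategory} {I J : Type} (f : J -> I)
    (nu : ultrafilter J)
    {M N : I -> C}
    (g : partial_family (ultra_map f nu) (fun i => hom (M i) (N i)))
    (gf : forall j, pf_dom g (f j)) :
  diag f nu N ∘ uprod_germ g
  = uprod_map nu (fun j => pf_val (exist (pf_dom g) (f j) (gf j)))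
      ∘ diag f nu M.
Proof.
have : restr_diag (pf_domP g) N ∘ uprod_germ g
     = uprod_map (ultra_restr (pf_domP g)) (@pf_val _ _ _ g)
         ∘ restr_diag (pf_domP g) M.
  by rewrite /uprod_germ !comp_assoc (invP (restr_diag_iso _ _)).2 comp_idl.
move: (uprod_germ g) => k.
rewrite /restr_diag; move: (ultra_restr _) (ultra_restrK _) => rho E.
pose f' j := exist (pf_dom g) (f j) (gf j).
have rhoE : ultra_map f' nu = rho by apply: ultra_map_sval_inj; rewrite E.
case: rho / rhoE E => E.
(* sval \o f' is f, so E relates convertible ultrafilters and its transport is
   the identity. *)
rewrite (Prop_irrelevance E (erefl (ultra_map f nu))) /= => H.
rewrite [X in X ∘ _ = _](diag_comp sval f') -comp_assoc.
rewrite [X in _ ∘ X = _]H comp_assoc.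
rewrite [X in X ∘ _ = _](diag_natural f' nu (@pf_val _ _ _ g)) -comp_assoc.
by rewrite -[X in _ ∘ X = _](diag_comp sval f').
Qed.

Lemma uprod_germ_eq {C : ultracategory} {I : Type} {mu : ultrafilter I}
    {M N : I -> C}
    (g h : partial_family mu (fun i => hom (M i) (N i))) :
  same_germ g h -> uprod_germ g = uprod_germ h.
Proof.
case=> V muV gh; have [nu E] := ultra_restrict mu V muV; subst mu.
apply: (is_iso_monic (diag_iso nu N (@sval_inj I V))).
have gV (j : {i | V i}) : pf_dom g (sval j) by have [gj _] := gh _ (svalP j).
have hV (j : {i | V i}) : pf_dom h (sval j).
  by have [_ [hj _]] := gh _ (svalP j).
rewrite (diag_uprod_germ_total _ _ _ gV) (diag_uprod_germ_total _ _ _ hV).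
congr comp; apply: eq_uprod_map => j.
have [gj [hj e]] := gh _ (svalP j).
by rewrite (Prop_irrelevance (gV j) gj) e (Prop_irrelevance (hV j) hj).
Qed.

Lemma uprod_germ_total {C : ultracategory} {I : Type} (mu : ultrafilter I)
    {M N : I -> C}
    (g : forall i, hom (M i) (N i)) :
  uprod_germ (pf_total mu g) = uprod_map mu g.
Proof.
have := diag_uprod_germ_total id mu (pf_total mu g) (fun=> Logic.I).
by rewrite !diag_id comp_idl comp_idr.
Qed.

(** Both sides agree after restriction to the preimage of the domain of g,
    where the composite map lands in that domain. *)
Lemma diag_uprod_germ {C : ultracategory} {I J : Type} (f : J -> I)
    (nu : ultrafilter J)
    {M N : I -> C}
    (g : partial_family (ultra_map f nu) (fun i => hom (M i) (N i))) :
  diag f nu N ∘ uprod_germ g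
  = uprod_germ (pf_reindex (S := fun i => hom (M i) (N i)) g) ∘ diag f nu M.
Proof.
(* U is kept abstract so that nu, on which the domain of g depends, can be
   substituted. *)
have [U [Ug nuU]] : exists U : set J, (forall j, U j -> pf_dom g (f j)) /\ nu U.
  by exists (fun j => pf_dom g (f j)); split=> //; exact: (pf_domP g).
have [rho E] := ultra_restrict nu U nuU; subst nu.
apply: (is_iso_monic (diag_iso rho _ (@sval_inj J U))).
have gf (j : {j | U j}) : pf_dom g (f (sval j)) by exact: Ug (svalP j).
rewrite [LHS]comp_assoc [RHS]comp_assoc -[X in X ∘ _ = _](diag_comp f sval).
rewrite (diag_uprod_germ_total sval rho
  (pf_reindex (S := fun i => hom (M i) (N i)) g) gf).
rewrite (diag_uprod_germ_total (fun j => f (sval j)) rho g gf) -[RHS]comp_assoc.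
congr comp; last exact: (diag_comp f sval).
by apply: eq_uprod_map => j; exact: (pf_val_irrelevance g).
Qed.

Lemma uprod_germ_comp {C : ultracategory} {I : Type} {mu : ultrafilter I}
    {L M N : I -> C}
    (r : partial_family mu (fun i => hom (L i) (N i)))
    (s : partial_family mu (fun i => hom (M i) (N i)))
    (t : partial_family mu (fun i => hom (L i) (M i))) (V : set I) :
  mu V ->
  (forall i, V i -> exists ri si ti, pf_val (exist (pf_dom r) i ri)
     = pf_val (exist (pf_dom s) i si) ∘ pf_val (exist (pf_dom t) i ti)) ->
  uprod_germ r = uprod_germ s ∘ uprod_germ t.
Proof.
move=> muV rst; have [nu E] := ultra_restrict mu V muV; subst mu.
apply: (is_iso_monic (diag_iso nu N (@sval_inj I V))).
have rV (j : {i | V i}) : pf_dom r (sval j) by have [rj _] := rst _ (svalP j).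
have sV (j : {i | V i}) : pf_dom s (sval j).
  by have [_ [sj _]] := rst _ (svalP j).
have tV (j : {i | V i}) : pf_dom t (sval j).
  by have [_ [_ [tj _]]] := rst _ (svalP j).
rewrite [RHS]comp_assoc (diag_uprod_germ_total _ _ _ rV).
rewrite (diag_uprod_germ_total _ _ _ sV) -[RHS]comp_assoc.
rewrite (diag_uprod_germ_total _ _ _ tV) [RHS]comp_assoc -uprod_map_comp.
congr comp; apply: eq_uprod_map => j.
have [rj [sj [tj e]]] := rst _ (svalP j).
by rewrite (Prop_irrelevance (rV j) rj) e (Prop_irrelevance (sV j) sj)
  (Prop_irrelevance (tV j) tj).
Qed.

(** * The associator and germs *)

Definition pf_slice {I : Type} {X : I -> Type} {mu : ultrafilter I}
    {lam : forall i, ultrafilter (X i)} {S : {i & X i} -> Type}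
    (h : partial_family (ultra_sum mu lam) S) (i : I)
    (hi : lam i (fun x => pf_dom h (existT X i x))) :
    partial_family (lam i) (fun x => S (existT X i x)) :=
  @PartialFamily _ _ (fun x => S (existT X i x))
    (fun x => pf_dom h (existT X i x)) hi
    (fun w => pf_val (exist (pf_dom h) (existT X i (sval w)) (svalP w))).

(** The germ of i |-> \int_(X_i) h_(i,x) dlam_i. *)
Definition pf_uprod {C : ultracategory} {I : Type} {X : I -> Type}
    {mu : ultrafilter I}
    {lam : forall i, ultrafilter (X i)} {M N : {i & X i} -> C}
    (h : partial_family (ultra_sum mu lam) (fun p => hom (M p) (N p))) :
    partial_family mu (fun i =>
      hom (uprod (lam i) (fun x => M (existT X i x)))
          (uprod (lam i) (fun x => N (existT X i x)))) :=
  @PartialFamily _ mu (fun i =>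
      hom (uprod (lam i) (fun x => M (existT X i x)))
          (uprod (lam i) (fun x => N (existT X i x))))
    (fun i => lam i (fun x => pf_dom h (existT X i x))) (pf_domP h)
    (fun u => uprod_germ (pf_slice h (sval u) (svalP u))).

(** When every slice of the domain of h is large, each lam_i is carried by its
    slice.  Restricting the lam_i simultaneously to the slices, which is an
    invertible operation on ultraproducts, makes h total; for total families
    the claim is [fubini_along_natural]. *)
Lemma fubini_along_germ_total {C : ultracategory} {I : Type} {X : I -> Type}
    (mu : ultrafilter I)
    (lam : forall i, ultrafilter (X i)) {M N : {i & X i} -> C}
    (h : partial_family (ultra_sum mu lam) (fun p => hom (M p) (N p)))
    (hX : forall i, lam i (fun x => pf_dom h (existT X i x))) :
  fubini_along mu (existT X) lam N ∘ uprod_germ h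
  = uprod_map mu (fun i => uprod_germ (pf_slice h i (hX i)))
      ∘ fubini_along mu (existT X) lam M.
Proof.
(* The slices are kept abstract so that lam can be substituted. *)
have [U [Uh lamU]] : exists U : forall i, set (X i),
    (forall i x, U i x -> pf_dom h (existT X i x)) /\ forall i, lam i (U i).
  by exists (fun i x => pf_dom h (existT X i x)).
have [lam' E] : exists lam' : forall i, ultrafilter {x | U i x},
    lam = fun i => ultra_map sval (lam' i).
  exists (fun i => ultra_restr (lamU i)).
  by apply: functional_extensionality_dep => i; rewrite ultra_restrK.
subst lam.
have iso i : is_iso (diag sval (lam' i) (fun x => N (existT X i x))).
  by apply: diag_iso; exact: sval_inj.
apply: (is_iso_monic (uprod_map_iso mu iso)).
pose phi := sum_map (fun i => @sval (X i) (U i)).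
have split_sum P :
    uprod_map mu (fun i => diag sval (lam' i) (fun x => P (existT X i x)))
      ∘ fubini_along mu (existT X) (fun i => ultra_map sval (lam' i)) P
    = fubini_along mu (existT _) lam' (fun p => P (phi p))
      ∘ diag phi (ultra_sum mu lam') P.
  rewrite -(fubini_along_source mu (existT X)).
  exact: (fubini_along_target mu phi (existT _)).
have hphi p : pf_dom h (phi p) by exact: Uh (svalP (projT2 p)).
rewrite comp_assoc split_sum -comp_assoc.
rewrite [X in _ ∘ X = _](diag_uprod_germ_total phi (ultra_sum mu lam') h hphi).
rewrite [LHS]comp_assoc fubini_along_natural -[LHS]comp_assoc -split_sum.
rewrite [LHS]comp_assoc [RHS]comp_assoc -!uprod_map_comp.
congr comp; apply: eq_uprod_map => i.
rewrite [RHS](diag_uprod_germ_total sval (lam' i) (pf_slice h i (hX i))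
  (fun j => hphi (existT _ i j))).
by congr comp; apply: eq_uprod_map => j; exact: (pf_val_irrelevance h).
Qed.

(** The slices of the domain of h are large for mu-almost all i only, so [mu]
    is first restricted to those i. *)
Lemma fubini_along_germ {C : ultracategory} {I : Type} {X : I -> Type}
    (mu : ultrafilter I)
    (lam : forall i, ultrafilter (X i)) {M N : {i & X i} -> C}
    (h : partial_family (ultra_sum mu lam) (fun p => hom (M p) (N p))) :
  fubini_along mu (existT X) lam N ∘ uprod_germ h
  = uprod_germ (pf_uprod h) ∘ fubini_along mu (existT X) lam M.
Proof.
(* Again abstract, so that mu can be substituted. *)
have [U [Uh muU]] : exists U : set I,
    (forall i, U i -> lam i (fun x => pf_dom h (existT X i x))) /\ mu U.
  by exists (fun i => lam i (fun x => pf_dom h (existT X i x)));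
    split=> //; exact: (pf_domP h).
have [rho E] := ultra_restrict mu U muU; subst mu.
apply: (is_iso_monic (diag_iso rho _ (@sval_inj I U))).
pose phi := @sum_reindex I {i | U i} sval X.
pose lamU (j : {i | U i}) := lam (sval j).
have split_sum P :
    diag sval rho (fun i => uprod (lam i) (fun x => P (existT X i x)))
      ∘ fubini_along (ultra_map sval rho) (existT X) lam P
    = fubini_along rho (existT _) lamU (fun p => P (phi p))
      ∘ diag phi (ultra_sum rho lamU) P.
  rewrite -(fubini_along_reindex sval rho (existT X)).
  exact: (fubini_along_target rho phi (existT _)).
have hU (j : {i | U i}) := Uh _ (svalP j).
rewrite comp_assoc split_sum -comp_assoc.
rewrite [X in _ ∘ X = _](diag_uprod_germ phi (ultra_sum rho lamU) h).
rewrite [LHS]comp_assoc.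
pose h' := @pf_reindex _ _ phi (ultra_sum rho lamU)
  (fun p => hom (M p) (N p)) h.
rewrite [X in X ∘ _ = _](fubini_along_germ_total rho lamU h' hU).
rewrite -[LHS]comp_assoc -split_sum [LHS]comp_assoc [RHS]comp_assoc; congr comp.
rewrite (diag_uprod_germ_total sval rho (pf_uprod h) hU); congr comp.
apply: eq_uprod_map => j; apply: uprod_germ_eq.
exists (fun x => pf_dom h (existT X (sval j) x)) => [|x hx]; first exact: hU.
by exists hx, hx; exact: (pf_val_irrelevance h).
Qed.

(** * Coherence of the associator *)

(** Both sides decompose along the maps k |-> (i, f_i k) from K_i to
    \coprod_I X_i. *)
Lemma associator_sum_map {C : ultracategory} {I : Type} {K X : I -> Type}
    (mu : ultrafilter I)
    (f : forall i, K i -> X i) (lam : forall i, ultrafilter (K i))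
    (N : forall i, X i -> C) :
  associator mu lam (fun i k => N i (f i k))
    ∘ diag (sum_map f) (ultra_sum mu lam) (fun p => N (projT1 p) (projT2 p))
  = uprod_map mu (fun i => diag (f i) (lam i) (N i))
      ∘ associator mu (fun i => ultra_map (f i) (lam i)) N.
Proof.
pose N' p := N (projT1 p) (projT2 p).
transitivity (fubini_along mu (fun i k => existT X i (f i k)) lam N').
  exact/esym/(fubini_along_target mu (sum_map f) (existT K)).
exact: (fubini_along_source mu (existT X)).
Qed.

(** Both sides decompose along the inclusions of the X_(f j) in
    \coprod_I X_i. *)
Lemma associator_sum_reindex {C : ultracategory} {I J : Type} {X : I -> Type}
    (f : J -> I)
    (mu : ultrafilter J) (lam : forall i, ultrafilter (X i))
    (N : forall i, X i -> C) :
  associator mu (fun j => lam (f j)) (fun j => N (f j))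
    ∘ diag (@sum_reindex I J f X) (ultra_sum mu (fun j => lam (f j)))
        (fun p => N (projT1 p) (projT2 p))
  = diag f mu (fun i => uprod (lam i) (N i))
      ∘ associator (ultra_map f mu) lam N.
Proof.
pose N' p := N (projT1 p) (projT2 p).
transitivity (fubini_along mu (fun j => existT X (f j))
  (fun j => lam (f j)) N').
  exact/esym/(fubini_along_target mu (@sum_reindex I J f X)
    (existT (fun j => X (f j)))).
exact: (fubini_along_reindex f mu (existT X)).
Qed.

(** Both sides decompose along the maps t |-> (i, (x, t)) from T_(i,x) to the
    iterated coproduct, in the two orders compared by [fubini_along_comp]. *)
Lemma associator_pentagon {C : ultracategory} {I : Type} {X : I -> Type}
    {T : forall i, X i -> Type} (mu : ultrafilter I)
    (lam : forall i, ultrafilter (X i)) (om : forall i x, ultrafilter (T i x))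
    (L : forall i x, T i x -> C) :
  associator mu lam (fun i x => uprod (om i x) (L i x))
    ∘ (associator (ultra_sum mu lam) (fun p => om (projT1 p) (projT2 p))
         (fun p => L (projT1 p) (projT2 p))
       ∘ diag (@sum_assoc I X T)
           (ultra_sum (ultra_sum mu lam) (fun p => om (projT1 p) (projT2 p)))
           (fun r => L (projT1 r) (projT1 (projT2 r)) (projT2 (projT2 r))))
  = uprod_map mu (fun i => associator (lam i) (om i) (L i))
      ∘ associator mu (fun i => ultra_sum (lam i) (om i))
          (fun i q => L i (projT1 q) (projT2 q)).
Proof.
pose L' (r : {i & {x : X i & T i x}}) :=
  L (projT1 r) (projT1 (projT2 r)) (projT2 (projT2 r)).
pose om' (p : {i & X i}) := om (projT1 p) (projT2 p).
pose T' (p : {i & X i}) := T (projT1 p) (projT2 p).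
pose h p (t : T' p) := @sum_assoc I X T (existT T' p t).
rewrite -[X in _ ∘ X = _](fubini_along_target (ultra_sum mu lam)
  (@sum_assoc I X T) (existT T') om' L').
rewrite [LHS](fubini_along_comp mu lam h om' L').
rewrite [X in _ = _ ∘ X]/associator [RHS]comp_assoc -uprod_map_comp.
congr comp; apply: eq_uprod_map => i.
exact: (fubini_along_target (lam i) (existT _ i) (existT (T i))).
Qed.

(** Over a principal ultrafilter the Fubini transform is inverse to [eps], so only the diagonal map inside the associator survives. *)
Lemma diag_unit_sum {C : ultracategory} {I : Type} (mu : ultrafilter I)
    (M : I -> C) :
  eps tt (fun _ => uprod mu M)
    ∘ associator (dirac tt) (fun _ : unit => mu) (fun _ => M)
  = diag (@unit_sum I) mu (fun p => M (projT2 p)).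
Proof.
rewrite /associator comp_assoc eps_natural -comp_assoc.
rewrite [X in _ ∘ X = _](fubini_dirac tt
  (fun u => ultra_map (existT (fun=> I) u) mu) (fun p => M (projT2 p))).2.
exact: comp_idr.
Qed.

(** Over the one-point fibres, delta_(i,tt) is the image of delta_tt, so the
    Fubini transform in the associator is the one in the diagonal map, and
    [eps_diag] compares the other factors. *)
Lemma diag_sum_unit {C : ultracategory} {I : Type} (mu : ultrafilter I)
    (M : I -> C) :
  uprod_map mu (fun i => eps tt (fun _ => M i))
    ∘ associator mu (fun _ => dirac tt) (fun i (_ : unit) => M i)
  = diag (@sum_unit I) mu (fun p => M (projT1 p)).
Proof.
rewrite /associator comp_assoc -uprod_map_comp /diag; congr comp.
apply: eq_uprod_map => i.
exact: (eps_diag (existT (fun=> unit) i) tt (fun p => M (projT1 p))).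
Qed.

(** * The generalised ultrastructure *)

(** This equation determines the composite, and replaces the inverse
    associator in all computations. *)
Lemma sub_gbeta_repP {C : ultracategory} (aiso : is_T_pseudo_algebra C)
    {B : set C}
    {A : {X : C | B X}} {I : Type} {mu : ultrafilter I}
    {M : I -> {X : C | B X}} {X : I -> Type}
    {lam : forall i, ultrafilter (X i)} {N : forall i, X i -> {X : C | B X}}
    (f : sub_ghom A mu M)
    (g : partial_family mu (fun i => sub_ghom (M i) (lam i) (N i))) :
  associator mu lam (fun i x => sval (N i x)) ∘ sub_gbeta_rep aiso f g
  = uprod_germ (M := fun i => sval (M i))
      (N := fun i => uprod (lam i) (fun x => sval (N i x))) g ∘ f.
Proof.
by rewrite /sub_gbeta_rep [LHS]comp_assoc [X in X ∘ _ = _]comp_assoc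
  (invP (aiso _ _ _ _ _)).2 comp_idl.
Qed.

Definition sub_gbeta {C : ultracategory} (aiso : is_T_pseudo_algebra C)
    (B : set C) (A : {X : C | B X}) (I : Type) (mu : ultrafilter I)
    (M : I -> {X : C | B X}) (X : I -> Type)
    (lam : forall i, ultrafilter (X i)) (N : forall i, X i -> {X : C | B X})
    (f : sub_ghom A mu M)
    (g : ultraproduct mu (fun i => sub_ghom (M i) (lam i) (N i))) :
    sub_ghom A (ultra_sum mu lam) (fun p => N (projT1 p) (projT2 p)) :=
  sub_gbeta_rep aiso f (repr g).

Lemma sub_gbeta_germ {C : ultracategory} (aiso : is_T_pseudo_algebra C)
    {B : set C}
    {A : {X : C | B X}} {I : Type} {mu : ultrafilter I}
    {M : I -> {X : C | B X}} {X : I -> Type}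
    {lam : forall i, ultrafilter (X i)} {N : forall i, X i -> {X : C | B X}}
    (f : sub_ghom A mu M)
    (g : partial_family mu (fun i => sub_ghom (M i) (lam i) (N i))) :
  sub_gbeta aiso B A I mu M X lam N f (germ g) = sub_gbeta_rep aiso f g.
Proof.
rewrite /sub_gbeta /sub_gbeta_rep; congr (_ ∘ _ ∘ _); apply: uprod_germ_eq.
by apply/germP; rewrite /germ reprK.
Qed.

Definition sub_gultra {C : ultracategory} (aiso : is_T_pseudo_algebra C)
    (B : set C) : gultra_data {X : C | B X} := {|
  ghom := @sub_ghom C B;
  gbeta := sub_gbeta aiso B;
  gxi := @sub_gxi C B;
  gkappa := @sub_gkappa C B |}.

Lemma sub_gxi_bij {C : ultracategory} {B : set C} (A : {X : C | B X})
    (I J : Type) (f : J -> I)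
    (mu : ultrafilter J) (M : I -> {X : C | B X}) :
  injective f ->
  bijective (@sub_gxi C B A I J f mu M : sub_ghom A (ultra_map f mu) M -> _).
Proof.
move=> finj; have [d [dK Kd]] := diag_iso mu (fun i => sval (M i)) finj.
exists (fun h => d ∘ h) => h; rewrite /sub_gxi comp_assoc.
  by rewrite dK comp_idl.
by rewrite Kd comp_idl.
Qed.

Lemma sub_beta_kappal {C : ultracategory} (aiso : is_T_pseudo_algebra C)
    (B : set C) (A : {X : C | B X}) (I : Type) (mu : ultrafilter I)
    (M : I -> {X : C | B X}) (h : sub_ghom A mu M) :
  @sub_gxi C B _ _ _ (@unit_sum I) mu (fun p => M (projT2 p))
    (sub_gbeta aiso B A unit (dirac tt) (fun=> A) (fun=> I) (fun=> mu) (fun=> M)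
       (@sub_gkappa C B A) (germ (pf_total (dirac tt) (fun=> h)))) = h.
Proof.
rewrite sub_gbeta_germ /sub_gxi.
rewrite -[X in X ∘ _ = _](diag_unit_sum mu (fun i => sval (M i))).
rewrite -[LHS]comp_assoc [X in _ ∘ X = _](sub_gbeta_repP aiso (N := fun=> M)
  (@sub_gkappa C B A) (pf_total (dirac tt) (fun=> h))).
rewrite [X in _ ∘ (X ∘ _) = _](uprod_germ_total (dirac tt) (fun=> h)).
rewrite [LHS]comp_assoc eps_natural -[LHS]comp_assoc.
by rewrite [X in _ ∘ X = _](invP (eps_iso tt _)).2 comp_idr.
Qed.

Lemma sub_beta_kappar {C : ultracategory} (aiso : is_T_pseudo_algebra C)
    (B : set C) (A : {X : C | B X}) (I : Type) (mu : ultrafilter I)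
    (M : I -> {X : C | B X}) (h : sub_ghom A mu M) :
  @sub_gxi C B _ _ _ (@sum_unit I) mu (fun p => M (projT1 p))
    (sub_gbeta aiso B A I mu M (fun=> unit) (fun=> dirac tt) (fun i _ => M i)
       h (germ (pf_total mu (fun i => sub_gkappa (M i))))) = h.
Proof.
rewrite sub_gbeta_germ /sub_gxi.
rewrite -[X in X ∘ _ = _](diag_sum_unit mu (fun i => sval (M i))).
rewrite -[LHS]comp_assoc [X in _ ∘ X = _](sub_gbeta_repP aiso
  (N := fun i _ => M i) h (pf_total mu (fun i => @sub_gkappa C B (M i)))).
rewrite [X in _ ∘ (X ∘ _) = _](uprod_germ_total mu
  (fun i => sub_gkappa (M i))).
rewrite [LHS]comp_assoc -uprod_map_comp.
rewrite [X in X ∘ _ = _](_ : _ = idm _) ?comp_idl // -uprod_map_id.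
by apply: eq_uprod_map => i; exact: (invP (eps_iso tt _)).2.
Qed.

Lemma sub_beta_xil {C : ultracategory} (aiso : is_T_pseudo_algebra C)
    (B : set C) (A : {X : C | B X}) (I : Type) (mu : ultrafilter I)
    (M : I -> {X : C | B X}) (K X : I -> Type) (f : forall i, K i -> X i)
    (lam : forall i, ultrafilter (K i)) (N : forall i, X i -> {X : C | B X})
    (h : sub_ghom A mu M)
    (g : partial_family mu
       (fun i => sub_ghom (M i) (ultra_map (f i) (lam i)) (N i))) :
  @sub_gxi C B _ _ _ (sum_map f) (ultra_sum mu lam)
    (fun p => N (projT1 p) (projT2 p)) (sub_gbeta_rep aiso h g)
  = sub_gbeta_rep (N := fun i k => N i (f i k)) aiso h
      (pf_map (fun i => @sub_gxi C B _ _ _ (f i) (lam i) (N i)) g).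
Proof.
pose N' i x := sval (N i x).
apply: (is_iso_monic (aiso I K mu lam (fun i k => N' i (f i k)))).
rewrite [RHS](sub_gbeta_repP aiso) [LHS]comp_assoc.
rewrite [X in X ∘ _ = _](associator_sum_map mu f lam N').
rewrite -[LHS]comp_assoc [X in _ ∘ X = _](sub_gbeta_repP aiso h g).
rewrite [LHS]comp_assoc.
rewrite -(uprod_germ_total mu (fun i => diag (f i) (lam i) (N' i))).
congr comp; apply: esym.
apply: (uprod_germ_comp (L := fun i => sval (M i))
  (M := fun i => uprod (ultra_map (f i) (lam i)) (N' i))
  (N := fun i => uprod (lam i) (fun k => N' i (f i k)))
  _ _ _ (pf_dom g)) => [|i gi]; first exact: pf_domP.
by exists gi, Logic.I, gi.
Qed.

Lemma sub_beta_xir {C : ultracategory} (aiso : is_T_pseudo_algebra C)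
    (B : set C) (A : {X : C | B X}) (I J : Type) (f : J -> I)
    (mu : ultrafilter J) (M : I -> {X : C | B X}) (X : I -> Type)
    (lam : forall i, ultrafilter (X i)) (N : forall i, X i -> {X : C | B X})
    (h : sub_ghom A (ultra_map f mu) M)
    (g : partial_family (ultra_map f mu)
       (fun i => sub_ghom (M i) (lam i) (N i))) :
  @sub_gxi C B _ _ _ (@sum_reindex I J f X) (ultra_sum mu (fun j => lam (f j)))
    (fun p => N (projT1 p) (projT2 p)) (sub_gbeta_rep aiso h g)
  = sub_gbeta_rep (N := fun j => N (f j)) aiso (@sub_gxi C B _ _ _ f mu M h)
      (pf_reindex g).
Proof.
pose N' i x := sval (N i x).
apply: (is_iso_monic (aiso J _ mu (fun j => lam (f j)) (fun j => N' (f j)))).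
rewrite [RHS](sub_gbeta_repP aiso) [LHS]comp_assoc.
rewrite [X in X ∘ _ = _](associator_sum_reindex f mu lam N').
rewrite -[LHS]comp_assoc [X in _ ∘ X = _](sub_gbeta_repP aiso h g).
rewrite [LHS]comp_assoc [RHS]comp_assoc; congr comp.
exact: diag_uprod_germ.
Qed.

(** After composition with the two associators that occur on the right, the
    pentagon and the naturality of the associator for the germ of h leave an
    equation between two ultraproducts of germs, which holds at every index i
    by [sub_gbeta_repP]. *)
Lemma sub_beta_assoc {C : ultracategory} (aiso : is_T_pseudo_algebra C)
    (B : set C) (A : {X : C | B X}) (I : Type) (mu : ultrafilter I)
    (M : I -> {X : C | B X}) (X : I -> Type)
    (lam : forall i, ultrafilter (X i)) (N : forall i, X i -> {X : C | B X})
    (T : forall i, X i -> Type) (om : forall i x, ultrafilter (T i x))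
    (L : forall i x, T i x -> {X : C | B X}) (f : sub_ghom A mu M)
    (g : partial_family mu (fun i => sub_ghom (M i) (lam i) (N i)))
    (h : partial_family (ultra_sum mu lam) (fun p =>
       sub_ghom (N (projT1 p) (projT2 p)) (om (projT1 p) (projT2 p))
         (L (projT1 p) (projT2 p)))) :
  @sub_gxi C B _ _ _ (@sum_assoc I X T)
    (ultra_sum (ultra_sum mu lam) (fun p => om (projT1 p) (projT2 p)))
    (fun r => L (projT1 r) (projT1 (projT2 r)) (projT2 (projT2 r)))
    (sub_gbeta_rep (N := fun i q => L i (projT1 q) (projT2 q)) aiso f
       (@pf_beta _ (sub_gultra aiso B) I mu M X lam N T om L g h))
  = sub_gbeta_rep (N := fun p => L (projT1 p) (projT2 p)) aiso
      (sub_gbeta_rep aiso f g) h.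
Proof.
pose L' i x t := sval (L i x t).
pose om' (p : {i & X i}) := om (projT1 p) (projT2 p).
apply: (is_iso_monic (aiso _ _ (ultra_sum mu lam) om'
  (fun p => L' (projT1 p) (projT2 p)))).
apply: (is_iso_monic (aiso _ _ mu lam
  (fun i x => uprod (om i x) (L' i x)))).
rewrite [X in _ = _ ∘ X](sub_gbeta_repP aiso
  (N := fun p => L (projT1 p) (projT2 p)) (sub_gbeta_rep aiso f g) h).
rewrite [RHS]comp_assoc.
rewrite [X in _ = X ∘ _](fubini_along_germ mu lam h).
rewrite -[RHS]comp_assoc [X in _ = _ ∘ X](sub_gbeta_repP aiso f g).
rewrite [RHS]comp_assoc.
rewrite [X in _ ∘ X = _]comp_assoc [LHS]comp_assoc.
rewrite [X in X ∘ _ = _](associator_pentagon mu lam om L').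
rewrite -[LHS]comp_assoc.
pose gh := @pf_beta _ (sub_gultra aiso B) I mu M X lam N T om L g h.
rewrite [X in _ ∘ X = _](sub_gbeta_repP aiso
  (N := fun i q => L i (projT1 q) (projT2 q)) f gh) [LHS]comp_assoc.
congr comp.
rewrite -(uprod_germ_total mu (fun i => associator (lam i) (om i) (L' i))).
(* The associator cancels its inverse in beta(g_i, [h_(i,x)]_x), so that r is
   the germ of the composites of g_i with \int_(X_i) h_(i,x) dlam_i. *)
pose r := pf_map (fun i => comp (associator (lam i) (om i) (L' i))) gh.
transitivity (uprod_germ r).
  apply: esym.
  apply: (uprod_germ_comp (L := fun i => sval (M i))
    (M := fun i => uprod (ultra_sum (lam i) (om i))
       (fun q => L' i (projT1 q) (projT2 q)))
    (N := fun i => uprod (lam i) (fun x => uprod (om i x) (L' i x)))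
    _ _ _ (pf_dom gh)) => [|i ghi]; first exact: pf_domP.
  by exists ghi, Logic.I, ghi.
apply: (uprod_germ_comp (L := fun i => sval (M i))
  (M := fun i => uprod (lam i) (fun x => sval (N i x)))
  (N := fun i => uprod (lam i) (fun x => uprod (om i x) (L' i x)))
  _ _ _ (pf_dom gh)) => [|i ghi]; first exact: pf_domP.
exists ghi, ghi.2, ghi.1.
rewrite [LHS]/= sub_gbeta_germ (sub_gbeta_repP aiso).
congr comp; last exact: (pf_val_irrelevance g).
apply: uprod_germ_eq.
exists (fun x => pf_dom h (existT X i x)) => [|x hx]; first exact: ghi.2.
by exists hx, hx; exact: (pf_val_irrelevance h (existT X i x)).
Qed.

Lemma unit_sum_inj {I : Type} : injective (@unit_sum I).
Proof. by move=> i j /(congr1 (fun p : {_ : unit & I} => projT2 p)). Qed.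

Lemma sum_unit_inj {I : Type} : injective (@sum_unit I).
Proof. by move=> i j /(congr1 (fun p : {_ : I & unit} => projT1 p)). Qed.

Theorem theorem5p8 (C : ultracategory) (aiso : is_T_pseudo_algebra C)
    (B : set C) :
  exists beta : forall (A : {X : C | B X}) (I : Type) (mu : ultrafilter I)
      (M : I -> {X : C | B X}) (X : I -> Type)
      (lam : forall i, ultrafilter (X i)) (N : forall i, X i -> {X : C | B X}),
      sub_ghom A mu M ->
      ultraproduct mu (fun i => sub_ghom (M i) (lam i) (N i)) ->
      sub_ghom A (ultra_sum mu lam) (fun p => N (projT1 p) (projT2 p)),
    (forall (A : {X : C | B X}) (I : Type) (mu : ultrafilter I)
       (M : I -> {X : C | B X}) (X : I -> Type)
       (lam : forall i, ultrafilter (X i)) (N : forall i, X i -> {X : C | B X})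
       (f : sub_ghom A mu M)
       (g : partial_family mu (fun i => sub_ghom (M i) (lam i) (N i))),
       beta A I mu M X lam N f (germ g) = sub_gbeta_rep aiso f g) /\
    gultra_axioms {|
      ghom := @sub_ghom C B;
      gbeta := beta;
      gxi := @sub_gxi C B;
      gkappa := @sub_gkappa C B |}.
Proof.
exists (sub_gbeta aiso B); split; first by move=> *; exact: sub_gbeta_germ.
split=> /=.
- by move=> A I mu M h; rewrite /sub_gxi [X in X ∘ _ = _]diag_id comp_idl.
- by move=> A I J f mu M; exact: sub_gxi_bij.
- move=> A I J K f g mu M h; rewrite /sub_gxi [RHS]comp_assoc; congr comp.
  exact: diag_comp.
- move=> A I mu M.
  (* Xi is bijective, so a right inverse of it is its inverse. *)
  have /bij_inj xi_inj := sub_gxi_bij A _ _ _ mu (fun p => M (projT2 p))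
    (@unit_sum_inj I).
  have betaK := sub_beta_kappal aiso B A I mu M.
  by split=> // h; apply: xi_inj; exact: betaK.
- move=> A I mu M.
  have /bij_inj xi_inj := sub_gxi_bij A _ _ _ mu (fun p => M (projT1 p))
    (@sum_unit_inj I).
  have betaK := sub_beta_kappar aiso B A I mu M.
  by split=> // h; apply: xi_inj; exact: betaK.
- by move=> A I mu M K X f lam N h g; rewrite !sub_gbeta_germ sub_beta_xil.
- by move=> A I J f mu M X lam N h g; rewrite !sub_gbeta_germ sub_beta_xir.
- move=> A I mu M X lam N T om L f g h; rewrite !sub_gbeta_germ.
  exact: sub_beta_assoc.
Qed.
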